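(* Let $\tilde F_k$ be the stable cluster variables of the framed Kronecker quiver with mutation sequence $(0,1,0,1,\ldots)$, and let $$S=\sum_{\text{simple partitions } P \text{ of } R_\infty}\mathrm{weight}(P)$$ be the partition function of simple partitions of the infinite row pyramid $R_\infty$ (all as defined in the context). Then $$\lim_{k\to\infty}\tilde F_k = 1+S,$$ the limit being taken coefficientwise as formal power series in $y_0,y_1$.
   Context: Quiver mutation. A quiver is a finite directed graph, possibly with multiple edges, without self-loops or 2-cycles; each vertex $v$ carries a label $\ell_v$. Mutation at a vertex $v$: (1) replace the label $\ell_v$ by $\bigl(\prod_{\text{arrows } u\to v}\ell_u+\prod_{\text{arrows } v\to u}\ell_u\bigr)/\ell_v$ (products over arrows with multiplicity, using the arrows before mutation); (2) for every 2-path $u\to v\to w$ add an arrow $u\to w$; (3) delete newly created self-loops and cancel newly created 2-cycles in pairs; (4) reverse all arrows incident to $v$. Framed Kronecker quiver $Q_0$: vertices $0,1$ and frozen vertices $0',1'$ (never mutated); arrows: two arrows $1\to 0$, one arrow $0\to 0'$, one arrow $1\to 1'$. Initial labels: $1$ at $0$ and $1$, $y_0$ at $0'$, $y_1$ at $1'$. Mutate successively at $0,1,0,1,\ldots$; $Q_k$ is the quiver after $k$ mutations and $F_k$ is the new label produced at the $k$-th mutation. $C_k$ is the $2\times2$ matrix whose $(i,j)$ entry is the number of arrows $i'\to j$ in $Q_k$ (negative if the arrows point $j\to i'$). $\tilde F_k$ is obtained from $F_k$ by replacing each monomial $y_0^{a_0}y_1^{a_1}$ by $y_0^{b_0}y_1^{b_1}$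 with $\vec b=C_k^{-1}\vec a$. Convention on parity: for odd $k$, $C_k^{-1}=\begin{bmatrix}k&-(k+1)\\k-1&-k\end{bmatrix}$, and for even $k$ it is the same expression with rows interchanged; to remove the alternation between $y_0$ and $y_1$ the odd form is used for all $k$, i.e. for all $k\ge1$ each monomial $y_0^{a}y_1^{b}$ of $F_k$ is replaced by $y_0^{ka-(k+1)b}y_1^{(k-1)a-kb}$. Infinite row pyramid $R_\infty$: a two-layer arrangement of stones, white on top and black below, extending infinitely toward the center from a left end and a right end. Left part: white stones $w_1,w_2,\ldots$ (from the left end inward) and black stones $b_1,b_2,\ldots$, where $b_i$ lies beneath both $w_i$ and $w_{i+1}$. Right part: white stones $w'_1,w'_2,\ldots$ (from the right end inward) and black stones $b'_1,b'_2,\ldots$, where $b'_i$ lies beneath both $w'_i$ and $w'_{i+1}$. The left-to-right order of white stones is $w_1,w_2,\ldots,\ldots,w'_2,w'_1$. A partition of $R_\infty$ is a configuration obtained by removing infinitely many stones so that only finitely many remain, subject to stability: if a stone is removed, then every stone lying on top of it is removed. It is simple if the removed white stones form one consecutive (infinite) block and no exposed black stone remains (a black stone is exposed if all white stones on top of it have been removed). The weight of a partition $P$ is $$\mathrm{weight}(P)=y_0^{(\#\text{ non-removed white stones})+1}\,y_1^{\#\text{ non-removed black stones}}.$$ *)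

(* Defs.v *)
From HB Require Import structures.
From mathcomp Require Import all_boot all_order all_algebra perm.
From mathcomp Require Import finmap mpoly fraction ring zify.

Set Implicit Arguments.
Unset Strict Implicit.
Unset Printing Implicit Defensive.

Import Order.TTheory GRing.Theory Num.Theory.
Local Open Scope ring_scope.

(* [arrows q u w] is the number of arrows u -> w. *)
Record quiver (V : finType) := Quiver {
  arrows :> V -> V -> nat;
  no_loop : forall u, arrows u u = 0%N;
  no_2cycle : forall u w, (arrows u w == 0%N) || (arrows w u == 0%N)
}.

Section Mutation.
Variable V : finType.
Implicit Types (a : V -> V -> nat) (q : quiver V) (u v w : V).

Definition add_2paths a v u w : nat := (a u w + a u v * a v w)%N.

(* Truncated subtraction cancels 2-cycles in pairs; on the diagonal it gives
   [n - n = 0], which deletes the self-loops. *)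
Definition cancel_2cycles a u w : nat := (a u w - a w u)%N.

Definition reverse_at a v u w : nat :=
  if (u == v) || (w == v) then a w u else a u w.

Definition mutate_arrows a v : V -> V -> nat :=
  reverse_at (cancel_2cycles (add_2paths a v)) v.

Lemma mutate_no_loop a v u : mutate_arrows a v u u = 0%N.
Proof.
by rewrite /mutate_arrows /reverse_at /cancel_2cycles subnn if_same.
Qed.

Lemma mutate_no_2cycle a v u w :
  (mutate_arrows a v u w == 0%N) || (mutate_arrows a v w u == 0%N).
Proof.
rewrite /mutate_arrows /reverse_at /cancel_2cycles [(w == v) || _]orbC.
by case: ifP => _; rewrite !subn_eq0 leq_total.
Qed.

Definition mutate_quiver q v : quiver V :=
  Quiver (mutate_no_loop q v) (mutate_no_2cycle q v).

Variable K : fieldType.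

Record labelled_quiver := LabelledQuiver {
  quiver_of :> quiver V;
  label : V -> K
}.

Definition mutate_label (Q : labelled_quiver) v u : K :=
  if u == v then
    (\prod_(x : V) label Q x ^+ Q x v + \prod_(x : V) label Q x ^+ Q v x)
      / label Q v
  else label Q u.

Definition mutate (Q : labelled_quiver) v : labelled_quiver :=
  LabelledQuiver (mutate_quiver Q v) (mutate_label Q v).

End Mutation.

(* [inl i] is the mutable vertex i and [inr i] the frozen vertex i'. *)
Definition vertex : finType := ('I_2 + 'I_2)%type.

Definition framed_kronecker_arrows (u w : vertex) : nat :=
  match u, w with
  | inl i, inl j => if (i == 1) && (j == 0) then 2%N else 0%N
  | inl i, inr j => if i == j then 1%N else 0%N
  | inr _, _ => 0%N
  end.

Lemma framed_kronecker_no_loop u : framed_kronecker_arrows u u = 0%N.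
Proof. by case: u => // -[[|[|//]] ?]. Qed.

Lemma framed_kronecker_no_2cycle u w :
  (framed_kronecker_arrows u w == 0%N) || (framed_kronecker_arrows w u == 0%N).
Proof. by case: u w => [[[|[|//]] ?]|?] [[[|[|//]] ?]|?] //=; rewrite orbT. Qed.

Definition framed_kronecker : quiver vertex :=
  Quiver framed_kronecker_no_loop framed_kronecker_no_2cycle.

(* Here ['X_0] and ['X_1] are the variables y_0 and y_1. *)
Definition ratfun : fieldType := {fraction {mpoly int[2]}}.

Definition initial_label (u : vertex) : ratfun :=
  match u with
  | inl _ => 1
  | inr i => tofrac ('X_i : {mpoly int[2]})
  end.

(* The vertex at which the k-th mutation takes place, for k >= 1. *)
Definition mutation_vertex (k : nat) : 'I_2 := if odd k then 0 else 1.

Fixpoint Q_ (k : nat) : labelled_quiver vertex ratfun :=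
  if k is k'.+1 then mutate (Q_ k') (inl (mutation_vertex k))
  else LabelledQuiver framed_kronecker initial_label.

(* F_k, for k >= 1; a priori only a rational function. *)
Definition cluster_variable (k : nat) : ratfun :=
  label (Q_ k) (inl (mutation_vertex k)).

Definition C_ (k : nat) : 'M[int]_2 :=
  \matrix_(i, j) ((Q_ k (inr i) (inl j))%:Z - (Q_ k (inl j) (inr i))%:Z).

(* The inverse of C_k, with its rows interchanged when k is even. *)
Definition stable_mx (k : nat) : 'M[int]_2 :=
  if odd k then invmx (C_ k) else xrow 0 1 (invmx (C_ k)).

Definition mx22 (a b c d : int) : 'M[int]_2 :=
  \matrix_(i, j) (if i == 0 then if j == 0 then a else b
                  else if j == 0 then c else d).

Lemma xrow_mx22 a b c d : xrow 0 1 (mx22 a b c d) = mx22 c d a b.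
Proof.
apply/matrixP=> i j; rewrite !mxE.
case: tpermP => [->|->|] //.
by case: i => [[|[|//]] ?] ne0 ne1; [case: ne0 | case: ne1]; apply: val_inj.
Qed.

Definition Q_arrows (k : nat) (u w : vertex) : nat :=
  match u, w with
  | inl i, inl j => if (i == mutation_vertex k) && (j != i) then 2%N else 0%N
  | inr i, inl j =>
      if j == mutation_vertex k then if i == 0 then k else k.-1 else 0%N
  | inl j, inr i =>
      if j == mutation_vertex k then 0%N else if i == 0 then k.+1 else k
  | inr _, inr _ => 0%N
  end.

Lemma Q_arrowsE k u w : (0 < k)%N -> Q_ k u w = Q_arrows k u w.
Proof.
case: k => // k _; elim: k u w => [|k IHk] u w.
  by case: u w => [[[|[|//]] ?]|[[|[|//]] ?]] [[[|[|//]] ?]|[[|[|//]] ?]].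
rewrite -[LHS]/(mutate_arrows (Q_ k.+1) (inl (mutation_vertex k.+2)) u w).
rewrite /mutate_arrows /reverse_at /cancel_2cycles /add_2paths !IHk.
rewrite /Q_arrows /mutation_vertex /= negbK.
case: u w => [[[|[|//]] ?]|[[|[|//]] ?]] [[[|[|//]] ?]|[[|[|//]] ?]];
  case: (odd k) => //=; rewrite ?eqE /= ?eqE /=; lia.
Qed.

(* For all k >= 1 the monomial y_0^a y_1^b is thus replaced by
   y_0^(ka - (k+1)b) y_1^((k-1)a - kb). *)
Lemma stable_mxE k : (0 < k)%N ->
  C_ k \in unitmx /\
  stable_mx k = mx22 k%:Z (- k.+1%:Z) (k%:Z - 1) (- k%:Z).
Proof.
move=> k_gt0; set M := mx22 _ _ _ _.
pose N := if odd k then M else mx22 (k%:Z - 1) (- k%:Z) k%:Z (- k.+1%:Z).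
have CN : C_ k *m N = 1%:M.
  apply/matrixP=> i j; rewrite !mxE big_ord_recl big_ord1 !mxE !Q_arrowsE //.
  rewrite /N /Q_arrows /mutation_vertex.
  case: i j => [[|[|//]] ?] [[|[|//]] ?]; case: (odd k) => /=;
    rewrite ?mxE ?eqE /=; case: k k_gt0 {M N} => // k _ /=;
    rewrite ?mulr1n; ring.
have [Cu _] := mulmx1_unit CN; split=> //.
have -> : stable_mx k = if odd k then N else xrow 0 1 N.
  by rewrite /stable_mx -[N](mulKmx Cu) CN mulmx1.
rewrite /N; case: odd => //.
exact: xrow_mx22.
Qed.

(* Laurent polynomials in y_0, y_1 are given by their coefficients, indexed by
   exponent vectors, and power series by the coefficients of y_0^i y_1^j. *)
Definition laurent := 'cV[int]_2 -> int.
Definition fps := nat -> nat -> int.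

Definition expo (i j : int) : 'cV[int]_2 := \col_r (if r == 0 then i else j).

Definition stable_expo (k : nat) (m : 'X_{1..2}) : 'cV[int]_2 :=
  stable_mx k *m \col_r (m r)%:Z.

Definition stable_laurent (k : nat) (p : {mpoly int[2]}) : laurent :=
  fun e => \sum_(m <- msupp p | stable_expo k m == e) p@_m.

(* The Laurent polynomial [L] has no negative exponent, and is the power
   series [f]. *)
Definition is_fps (L : laurent) (f : fps) : Prop :=
  (forall i j : nat, L (expo i j) = f i j) /\
  (forall i j : int, (i < 0) || (j < 0) -> L (expo i j) = 0).

(* [f] is the stable cluster variable obtained from F_k. *)
Definition stable_cluster_variable (k : nat) (f : fps) : Prop :=
  exists2 p : {mpoly int[2]},
    tofrac p = cluster_variable k & is_fps (stable_laurent k p) f.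

Definition fps_monomial (a b : nat) : fps :=
  fun i j => if (i == a) && (j == b) then 1 else 0.

Definition fps_add (f g : fps) : fps := fun i j => f i j + g i j.

Definition fps_one : fps := fps_monomial 0 0.

(* [S] is the (possibly infinite) sum of the family of the [f x] for [x]
   satisfying [A]: only finitely many terms contribute to each coefficient. *)
Definition is_fps_sum (T : choiceType) (A : T -> Prop) (f : T -> fps)
    (S : fps) : Prop :=
  forall i j, exists2 X : {fset T},
    forall x, x \in X <-> A x /\ f x i j <> 0
  & S i j = \sum_(x <- X) f x i j.

Definition fps_limit (f : nat -> fps) (g : fps) : Prop :=
  forall i j, exists N, forall k, (N <= k)%N -> f k i j = g i j.

(* Indices are shifted by one: [WhiteL i], [BlackL i], [WhiteR i], [BlackR i]
   are w_(i+1), b_(i+1), w'_(i+1), b'_(i+1). *)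
Inductive stone :=
  | WhiteL of nat | BlackL of nat | WhiteR of nat | BlackR of nat.

Definition stone_encode (s : stone) : (nat + nat) + (nat + nat) :=
  match s with
  | WhiteL i => inl (inl i) | BlackL i => inl (inr i)
  | WhiteR i => inr (inl i) | BlackR i => inr (inr i)
  end.

Definition stone_decode (c : (nat + nat) + (nat + nat)) : stone :=
  match c with
  | inl (inl i) => WhiteL i | inl (inr i) => BlackL i
  | inr (inl i) => WhiteR i | inr (inr i) => BlackR i
  end.

Lemma stone_encodeK : cancel stone_encode stone_decode.
Proof. by case. Qed.

HB.instance Definition _ := Countable.copy stone (can_type stone_encodeK).

Definition white (s : stone) : bool :=
  match s with WhiteL _ | WhiteR _ => true | _ => false end.

Definition black (s : stone) : bool := ~~ white s.

(* [on_top s t]: the stone [s] lies on top of the stone [t]. *)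
Definition on_top (s t : stone) : bool :=
  match s, t with
  | WhiteL i, BlackL j | WhiteR i, BlackR j => (i == j) || (i == j.+1)
  | _, _ => false
  end.

(* The left-to-right order of the white stones. *)
Definition left_of (s t : stone) : bool :=
  match s, t with
  | WhiteL i, WhiteL j => (i < j)%N
  | WhiteL _, WhiteR _ => true
  | WhiteR i, WhiteR j => (j < i)%N
  | _, _ => false
  end.

(* A configuration is given by the finite set of its non-removed stones. *)
Definition is_partition (P : {fset stone}) : Prop :=
  forall s t, t \notin P -> on_top s t -> s \notin P.

Definition exposed (P : {fset stone}) (t : stone) : Prop :=
  black t /\ forall s, on_top s t -> s \notin P.

(* The block of removed white stones is infinite because [P] is finite. *)
Definition simple_partition (P : {fset stone}) : Prop :=
  [/\ is_partition P,
      forall r s t, white r -> white s -> white t ->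
        left_of r s -> left_of s t -> r \notin P -> t \notin P -> s \notin P
    & forall t, t \in P -> ~ exposed P t].

Definition weight (P : {fset stone}) : fps :=
  fps_monomial (count white P).+1 (count black P).

(* Main.v *)
(* The exchange relation F_(k+1) F_(k-1) = F_k^2 + y_0^(k+1) y_1^k has the
   solution of the linear recurrence
   F_(k+1) = (1 + y_0 + y_0 y_1) F_k - y_0 y_1 F_(k-1), whose coefficient of
   y_0^a y_1^b is C(k-b, a-b) C(a-1, b).  It vanishes unless a = b = 0 or
   b < a <= k.  In the latter case, with d = a - b, the substitution sends
   y_0^a y_1^b to y_0^i y_1^j with i - j = d and i = kd - b >= k(d-1) + d, so
   for fixed i and large k only d = 1 survives, with coefficient i.  Hence the
   limit is 1 + sum_i i y_0^i y_1^(i-1).  On the other side, a simple partition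
   keeps m white and m black stones at the left end, and n of each at the right
   end; i of these have m + n = i - 1. *)
Require Import Defs.
From mathcomp Require Import all_boot all_order all_algebra.
From mathcomp Require Import finmap mpoly fraction ring zify.

Set Implicit Arguments.
Unset Strict Implicit.
Unset Printing Implicit Defensive.

Import Order.TTheory GRing.Theory Num.Theory.
Local Open Scope ring_scope.

(** * The polynomials F_k: exchange relation and coefficients *)

Lemma mcoeffMXU n (R : nzRingType) (p : {mpoly R[n]}) i (m : 'X_{1..n}) :
  (p * 'X_i)@_m = if m i == 0%N then 0 else p@_(m - U_(i)).
Proof.
have [mi0|mi0] := eqVneq (m i) 0%N; last first.
  have mE : m = (U_(i) + (m - U_(i)))%MM by rewrite addmC submK ?lep1mP.
  by rewrite {1}mE mcoeffMX.
apply/eqP; rewrite mcoeff_eq0 (perm_mem (msuppMX _ _)).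
apply/mapP=> -[m' _ mE]; move: mi0.
by rewrite mE mnmDE mnm1E eqxx; lia.
Qed.

(* Indexed as F_k, with F_0 = 1 the initial label of the vertex 1. *)
Fixpoint Fpoly (k : nat) : {mpoly int[2]} :=
  match k with
  | 0 => 1
  | k'.+1 =>
    if k' is k''.+1 then
      Fpoly k' + Fpoly k' * 'X_0 + Fpoly k' * 'X_0 * 'X_1
        - Fpoly k'' * 'X_0 * 'X_1
    else 1 + 'X_0
  end.

Lemma FpolySS k :
  Fpoly k.+2 = Fpoly k.+1 + Fpoly k.+1 * 'X_0 + Fpoly k.+1 * 'X_0 * 'X_1
    - Fpoly k * 'X_0 * 'X_1.
Proof. by []. Qed.

(** A Cassini-type identity: for a solution of the linear recurrence, F_(k+2) F_k - F_(k+1)^2 gets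
    multiplied by y_0 y_1 when k increases by one, and it starts at y_0^2 y_1. *)
Lemma Fpoly_exchange k :
  Fpoly k.+2 * Fpoly k = Fpoly k.+1 ^+ 2 + 'X_0 ^+ k.+2 * 'X_1 ^+ k.+1.
Proof.
elim: k => [|k IHk]; first by rewrite FpolySS /=; ring.
have -> : 'X_0 ^+ k.+3 * 'X_1 ^+ k.+2 =
    ('X_0 ^+ k.+2 * 'X_1 ^+ k.+1) * ('X_0 * 'X_1) :> {mpoly int[2]}.
  by rewrite !exprS; ring.
have -> : 'X_0 ^+ k.+2 * 'X_1 ^+ k.+1 = Fpoly k.+2 * Fpoly k - Fpoly k.+1 ^+ 2.
  by rewrite IHk addrC addKr.
rewrite [Fpoly k.+3]FpolySS [Fpoly k.+2]FpolySS; ring.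
Qed.

(* The truncations are harmless: the product is 0 for b > a > 0 and for b > k,
   and at a = 0 it is 1 if b = 0 and 0 otherwise. *)
Definition Fcoef (k a b : nat) : nat := 'C(k - b, a - b) * 'C(a.-1, b).

(** This is the linear recurrence read on coefficients. Pascal's rule on both binomial factors
    settles the generic case b < a; the other cases are those where a truncation blocks Pascal's
    rule. *)
Lemma FcoefSS k a b : (0 < a)%N -> (0 < b)%N ->
  (Fcoef k.+2 a b + Fcoef k a.-1 b.-1 =
    Fcoef k.+1 a b + Fcoef k.+1 a.-1 b + Fcoef k.+1 a.-1 b.-1)%N.
Proof.
case: a b => [|a] [|b] //= _ _; rewrite /Fcoef /= !subSS.
have [lt_ab|le_ba] := ltnP a b.
  by rewrite !(bin_small (n := a)) ?(bin_small (n := a.-1))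
    ?(@bin_small a.-1 b) //; lia.
case: (posnP a) le_ba => [->|a_gt0 le_ba].
  by rewrite leqn0 => /eqP->; rewrite !muln0 /= !bin0 //.
have [ab|lt_ba] := eqVneq a b.
  subst b; rewrite (@bin_small a a.+1) // (@bin_small a.-1 a.+1)
    ?(@bin_small a.-1 a) //; lia.
have [d dE] : exists d, (a = b + d.+1)%N by exists (a - b).-1; lia.
have -> : (a - b.+1 = d)%N by lia.
have -> : (a - b = d.+1)%N by lia.
have [a' aE] : exists a', a = a'.+1 by exists a.-1; lia.
rewrite aE /= [in LHS]binS.
have [le_bk|lt_kb] := leqP b k.
  by rewrite subSn // !binS; lia.
(* Both differences truncate to 0 here. Only d = 0 can leave a nonzero term, and then a' = b, so
   that C(a', b+1) = 0. *)
have -> : (k.+1 - b = 0)%N by lia.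
have -> : (k - b = 0)%N by lia.
rewrite !bin0n; case: d dE => [|d] dE; last by lia.
by rewrite (@bin_small a' b.+1) ?addn0; lia.
Qed.

Lemma Fcoef0n k b : Fcoef k 0 b = (b == 0%N).
Proof. by rewrite /Fcoef sub0n bin0 mul1n bin0n. Qed.

Lemma FcoefSn0 k a :
  (0 < a)%N -> Fcoef k.+1 a 0 = (Fcoef k a 0 + Fcoef k a.-1 0)%N.
Proof. by case: a => // a _; rewrite /Fcoef !subn0 !bin0 !muln1 binS. Qed.

Lemma Fcoef0 a b : Fcoef 0 a b = (a == 0%N) && (b == 0%N).
Proof.
have [->|a_gt0] := posnP a; first by rewrite Fcoef0n.
rewrite /Fcoef sub0n bin0n subn_eq0 /=.
by case: leqP => // ?; rewrite bin_small //; lia.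
Qed.

Lemma Fcoef1 a b : Fcoef 1 a b = ((a <= 1) && (b == 0))%N.
Proof.
have [->|a_gt0] := posnP a; first by rewrite Fcoef0n.
have [->|b_gt0] := posnP b.
  by rewrite FcoefSn0 // !Fcoef0 !andbT; case: a a_gt0 => [|[|]].
rewrite andbF /Fcoef -subn_eq0 in b_gt0 *; rewrite (eqP b_gt0) bin0n subn_eq0.
by case: leqP => // ?; rewrite bin_small //; lia.
Qed.

Lemma ord2P (i : 'I_2) : i = 0 \/ i = 1.
Proof. by case: i => [[|[|//]] ?]; [left|right]; apply: val_inj. Qed.

Lemma ord1E : lift ord0 ord0 = 1 :> 'I_2. Proof. exact: val_inj. Qed.

Lemma mnm2_eq (m n : 'X_{1..2}) : (m == n) = (m 0 == n 0) && (m 1 == n 1).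
Proof.
apply/eqP/andP=> [-> //|[/eqP eq0 /eqP eq1]]; apply/mnmP=> i.
by have [->|->] := ord2P i.
Qed.

Lemma mcoeff_Fpoly k (m : 'X_{1..2}) :
  (Fpoly k)@_m = (Fcoef k (m 0) (m 1))%:Z.
Proof.
suff : (Fpoly k)@_m = (Fcoef k (m 0) (m 1))%:Z /\
       (Fpoly k.+1)@_m = (Fcoef k.+1 (m 0) (m 1))%:Z by case.
elim: k m => [|k IHk] m.
  rewrite /= mcoeffD mcoeff1 mcoeffX !mnm2_eq !mnm1E !mnmE !eqxx /=.
  by rewrite Fcoef0 Fcoef1; case: (m 0) (m 1) => [|[|a]] [|b].
split; first by case: (IHk m).
rewrite FpolySS mcoeffB !mcoeffD !mcoeffMXU.
rewrite !(fun m => (IHk m).1, fun m => (IHk m).2) !mnmBE !mnm1E /=.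
rewrite !subn0 !subn1.
have [->|m0] := posnP (m 0).
  by rewrite !Fcoef0n /= !if_same subr0 !addr0.
have [->|m1] := posnP (m 1); first by rewrite (FcoefSn0 k.+1) //=; lia.
by have := FcoefSS k m0 m1; lia.
Qed.

(** * Cluster variables are the polynomials F_k *)

Lemma Fpoly_neq0 k : Fpoly k != 0.
Proof.
apply/eqP=> /(congr1 (mcoeff 0%MM)).
by rewrite mcoeff_Fpoly mcoeff0 !mnmE Fcoef0n.
Qed.

(** By [Q_arrowsE] the next vertex to mutate receives two arrows from the vertex labelled F_(k+1),
    and sends k+2 arrows to 0' and k+1 to 1'. Its old label is F_k, so the mutation rule is exactly
    [Fpoly_exchange]. *)
Lemma label_Q k :
  [/\ label (Q_ k.+1) (inl (mutation_vertex k.+1)) = tofrac (Fpoly k.+1),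
      label (Q_ k.+1) (inl (mutation_vertex k)) = tofrac (Fpoly k)
    & forall i, label (Q_ k.+1) (inr i) = tofrac 'X_i].
Proof.
elim: k => [|k [IH1 IH0 IHf]].
  split=> //.
  rewrite /= /mutate_label /= !big_sumType !big_ord_recl !big_ord0 /=.
  rewrite !expr0 !expr1n !mulr1 !mul1r expr1 divr1.
  by rewrite tofracD tofrac1.
have vNv : mutation_vertex k.+2 = mutation_vertex k.
  by rewrite /mutation_vertex /= negbK.
split.
- rewrite -[LHS]/(mutate_label (Q_ k.+1) _ _) /mutate_label eqxx.
  rewrite vNv IH0.
  rewrite !big_sumType !big_ord_recl !big_ord0 !Q_arrowsE // !IHf ord1E.
  rewrite -[ord0]/(0 : 'I_2).
  apply: (mulIf (_ : tofrac (Fpoly k) != 0)); first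
    by rewrite tofrac_eq0 Fpoly_neq0.
  rewrite divfK ?tofrac_eq0 ?Fpoly_neq0 // -tofracM Fpoly_exchange.
  rewrite tofracD (tofracXn 2) tofracM !tofracXn.
  move: (label (Q_ k.+1)) (tofrac (Fpoly k.+1)) IH0 IH1 => L f.
  rewrite /Q_arrows /mutation_vertex /=.
  by case: (odd k) => /= -> ->; rewrite ?eqE /= !expr0 ?(mul1r, mulr1, expr2).
- rewrite -[LHS]/(mutate_label (Q_ k.+1) _ _) /mutate_label IH1.
  case: eqP => // -[]; rewrite /mutation_vertex /=.
  by case: (odd k).
by move=> i; exact: IHf.
Qed.

(** * The stable substitution and its limit *)

Lemma expo_eq i j i' j' : (expo i j == expo i' j') = (i == i') && (j == j').
Proof.
apply/eqP/andP=> [/matrixP eqij|[/eqP-> /eqP->] //].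
by have := (eqij 0 0, eqij 1 0); rewrite !mxE /= => -[-> ->].
Qed.

Lemma stable_expoE k m : (0 < k)%N ->
  stable_expo k m = expo (k%:Z * (m 0)%:Z - k.+1%:Z * (m 1)%:Z)
                         ((k%:Z - 1) * (m 0)%:Z - k%:Z * (m 1)%:Z).
Proof.
move=> k_gt0; rewrite /stable_expo (stable_mxE k_gt0).2.
apply/matrixP=> i j; rewrite !mxE big_ord_recl big_ord1 !mxE.
by have [->|->] := ord2P i; rewrite /= ord1E !mulNr.
Qed.

(** The image (i, j) of (a, b) satisfies i - j = a - b and b = k (a - b) - i, which recovers (a, b).
    Hence no two monomials merge under the substitution. *)
Lemma stable_expo_inj k : (0 < k)%N -> injective (stable_expo k).
Proof.
move=> k_gt0 m n /eqP; rewrite !stable_expoE // expo_eq.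
move=> /andP[/eqP e0 /eqP e1].
apply/eqP; rewrite mnm2_eq.
have e01 : (m 0)%:Z - (m 1)%:Z = (n 0)%:Z - (n 1)%:Z by lia.
have e : (m 1)%:Z = k%:Z * ((m 0)%:Z - (m 1)%:Z) -
    (k%:Z * (n 0)%:Z - k.+1%:Z * (n 1)%:Z).
  by rewrite -e0; lia.
rewrite e01 in e; apply/andP; split; apply/eqP; lia.
Qed.

Lemma stable_laurentE k p m : (0 < k)%N ->
  stable_laurent k p (stable_expo k m) = p@_m.
Proof.
move=> k_gt0; rewrite /stable_laurent.
rewrite (eq_bigl (pred1 m)); last first.
  by move=> n; apply: inj_eq; apply: stable_expo_inj.
have [m_p|m_p] := boolP (m \in msupp p).
  by rewrite -big_filter filter_pred1_uniq ?msupp_uniq ?big_seq1.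
rewrite big_seq_cond big1; first by apply/esym/eqP; rewrite mcoeff_eq0.
by move=> n /andP[n_p /eqP nm]; rewrite -nm n_p in m_p.
Qed.

(** The second binomial forces b < a and the first a <= k. Here d stands for a - b - 1, so that it
    starts at 0. *)
Lemma Fcoef_neq0 k a b : Fcoef k a b != 0%N ->
  (a = 0%N) /\ (b = 0%N) \/ exists2 d, a = (b + d.+1)%N & (b + d < k)%N.
Proof.
case: a => [|a]; first by rewrite Fcoef0n; case: b; [left|].
rewrite /Fcoef -lt0n muln_gt0 !bin_gt0 /= => /andP[le_k le_ba].
by right; exists (a - b)%N; lia.
Qed.

Lemma stable_laurent_Fpoly_eq0 k (e : 'cV[int]_2) :
  (forall m, stable_expo k m = e -> (Fpoly k)@_m = 0) ->
  stable_laurent k (Fpoly k) e = 0.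
Proof. by move=> me0; apply: big1 => m /eqP /me0. Qed.

Lemma stable_laurent_Fpoly_neg k i j : (0 < k)%N -> (i < 0) || (j < 0) ->
  stable_laurent k (Fpoly k) (expo i j) = 0.
Proof.
move=> k_gt0 ij_neg; apply: stable_laurent_Fpoly_eq0 => m /eqP.
rewrite stable_expoE // expo_eq => /andP[/eqP iE /eqP jE].
rewrite mcoeff_Fpoly; apply/eqP; apply: contraLR ij_neg => /Fcoef_neq0.
rewrite -{}iE -{}jE negb_or -!leNgt => -[[-> ->]|[d dE lt_k]].
  by rewrite !mulr0.
(* The exponents are i = k (d+1) - b > 0 and j = (k-1)(d+1) - b >= k d, the latter because b + d <
   k. *)
by rewrite dE; nia.
Qed.

Lemma stable_laurent_Fpoly_lim k (i j : nat) : (i < k)%N ->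
  stable_laurent k (Fpoly k) (expo i j) =
    (if (i == 0%N) && (j == 0%N) then 1 else 0) +
    (if i == j.+1 then i%:Z else 0).
Proof.
move=> lt_ik; have k_gt0 : (0 < k)%N by lia.
have [/andP[/eqP-> /eqP->]|ij_neq0] /= := boolP ((i == 0%N) && _).
  have -> : expo 0%N 0%N = stable_expo k 0%MM.
    by rewrite stable_expoE // !mnmE !mulr0.
  by rewrite stable_laurentE // mcoeff_Fpoly !mnmE Fcoef0n.
rewrite add0r; case: eqP => [iE|/eqP iNj].
  (* Solving for the preimage with a - b = 1 gives b = k - i and a = b + 1 = k - j. *)
  subst i; pose m : 'X_{1..2} :=
    [multinom if r == 0%R then k - j else k - j.+1 | r < 2].
  have -> : expo j.+1 j = stable_expo k m.
    by apply/eqP; rewrite stable_expoE // expo_eq !mnmE /=; lia.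
  rewrite stable_laurentE // mcoeff_Fpoly !mnmE /= /Fcoef.
  have -> : (k - (k - j.+1) = j.+1)%N by lia.
  have -> : (k - j - (k - j.+1) = 1)%N by lia.
  have -> : ((k - j).-1 = k - j.+1)%N by lia.
  by rewrite bin1 binn muln1.
apply: stable_laurent_Fpoly_eq0 => m /eqP.
rewrite stable_expoE // expo_eq => /andP[/eqP iE /eqP jE].
rewrite mcoeff_Fpoly; apply/eqP; apply: contraLR iNj => /Fcoef_neq0.
case=> [[m0 m1]|[d dE lt_k]].
  by move: ij_neq0; rewrite m0 m1 in iE jE *; lia.
rewrite dE in iE jE.
(* Since b < k, i = k (d+1) - b exceeds k d, so i < k leaves only d = 0; this means i = j + 1. *)
have d0 : d = 0%N by nia.
by rewrite d0 in iE jE; rewrite negbK; apply/eqP; lia.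
Qed.

(** * Classification of simple partitions *)

Local Open Scope fset_scope.

(* What a simple partition leaves: m columns at the left end, n at the right. *)
Definition wedge_seq (m n : nat) : seq stone :=
  map WhiteL (iota 0 m) ++ map WhiteR (iota 0 n) ++
  (map BlackL (iota 0 m) ++ map BlackR (iota 0 n)).

Definition wedge (m n : nat) : {fset stone} := [fset x in wedge_seq m n].

Lemma WhiteL_inj : injective WhiteL. Proof. by move=> i j []. Qed.
Lemma WhiteR_inj : injective WhiteR. Proof. by move=> i j []. Qed.
Lemma BlackL_inj : injective BlackL. Proof. by move=> i j []. Qed.
Lemma BlackR_inj : injective BlackR. Proof. by move=> i j []. Qed.

Lemma in_wedge m n s :
  (s \in wedge m n) =
    match s with
    | WhiteL i | BlackL i => (i < m)%N
    | WhiteR i | BlackR i => (i < n)%N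
    end.
Proof.
have map_disj (f g : nat -> stone) r i : (forall i j, g i <> f j) ->
    (g i \in map f r) = false.
  by move=> fNg; apply/negP=> /mapP[j _ /fNg].
have iotaE l i : (i \in iota 0 l) = (i < l)%N by rewrite mem_iota.
rewrite in_fset /= !mem_cat.
case: s => i; rewrite ?(mem_map WhiteL_inj, mem_map WhiteR_inj,
  mem_map BlackL_inj, mem_map BlackR_inj) ?map_disj // !iotaE ?orbF //.
Qed.

Lemma wedge_seq_uniq m n : uniq (wedge_seq m n).
Proof.
rewrite !cat_uniq !map_inj_uniq ?iota_uniq //=;
  try exact: WhiteL_inj; try exact: WhiteR_inj;
  try exact: BlackL_inj; try exact: BlackR_inj.
rewrite andbT; apply/and3P; split; apply/hasPn=> s; rewrite ?mem_cat.
- by case/or3P => /mapP[i _ ->]; apply/mapP=> -[].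
- by case/orP => /mapP[i _ ->]; apply/mapP=> -[].
by case/mapP=> i _ ->; apply/mapP=> -[].
Qed.

Lemma count_wedge (a : pred stone) m n :
  count a (wedge m n) = count a (wedge_seq m n).
Proof.
apply/permP/uniq_perm; rewrite ?fset_uniq ?wedge_seq_uniq // => s.
by rewrite in_fset.
Qed.

Lemma weight_wedge m n : weight (wedge m n) = fps_monomial (m + n).+1 (m + n).
Proof.
have E (a : pred stone) f (b : bool) l : (forall i, a (f i) = b) ->
    count a (map f (iota 0 l)) = (b * l)%N.
  move=> afE; rewrite count_map (eq_count (a2 := fun=> b)) //.
  by case: b {afE}; rewrite ?count_predT ?count_pred0 ?size_iota ?mul1n.
rewrite /weight !count_wedge /wedge_seq !count_cat.
rewrite (E white WhiteL true) // (E white WhiteR true) //.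
rewrite (E white BlackL false) // (E white BlackR false) //.
rewrite (E black WhiteL false) // (E black WhiteR false) //.
rewrite (E black BlackL true) // (E black BlackR true) //.
by rewrite !mul1n !mul0n !addn0.
Qed.

(** Pigeonhole on one more value of [f] than [P] has elements. It supplies removed stones
    arbitrarily far toward the center. *)
Lemma fset_notin (T : choiceType) (P : {fset T}) (f : nat -> T) (b : nat) :
  injective f -> exists2 i, (b <= i)%N & f i \notin P.
Proof.
move=> f_inj; have [/hasP[i]|/hasPn all_in] :=
    boolP (has (fun i => f i \notin P) (iota b (size P).+1)).
  by rewrite mem_iota => /andP[le_bi _]; exists i.
have : (size (map f (iota b (size P).+1)) <= size P)%N.
  apply: uniq_leq_size; first by rewrite map_inj_uniq ?iota_uniq.
  by move=> _ /mapP[i /all_in fiP ->]; rewrite negbK in fiP.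
by rewrite size_map size_iota ltnn.
Qed.

Lemma fset_initial (T : choiceType) (P : {fset T}) (f : nat -> T) :
  injective f -> (forall i j, (i < j)%N -> f j \in P -> f i \in P) ->
  exists m, forall i, (f i \in P) = (i < m)%N.
Proof.
move=> f_inj f_down.
have ex_out : exists i, f i \notin P.
  by have [i _ fiP] := fset_notin P 0 f_inj; exists i.
case: (ex_minnP ex_out) => m fmP m_min; exists m => i.
have [lt_im|le_mi] := ltnP i m.
  by apply/negPn/negP=> /m_min; rewrite leqNgt lt_im.
apply/negP=> fiP; move/negP: fmP; apply.
move: le_mi; rewrite leq_eqVlt => /predU1P[-> //|/f_down]; exact.
Qed.

(** A kept white stone with a removed one on its outer side would lie between two removed ones, as
    some stone further inward is removed; so the kept white stones form an initial segment at each
    end. Stability keeps the black stone of each kept index, and the ban on exposed stones removes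
    all others. *)
Lemma simple_partitionP P :
  simple_partition P <-> exists m n, P = wedge m n.
Proof.
split=> [[Ppart Pblock Pexp]|[m [n ->]]]; last first.
  split.
  - by case=> i [] j //; rewrite !in_wedge -!leqNgt => le /orP[]/eqP->; lia.
  - case=> i [] j // [] k //; rewrite !in_wedge -!leqNgt /=; lia.
  - move=> t; rewrite in_wedge => t_in [t_black t_exp].
    case: t t_in t_black t_exp => i //= i_in _.
      by move=> /(_ (WhiteL i)); rewrite /= eqxx in_wedge i_in => /(_ isT).
    by move=> /(_ (WhiteR i)); rewrite /= eqxx in_wedge i_in => /(_ isT).
have [m mP] : exists m, forall i, (WhiteL i \in P) = (i < m)%N.
  apply: fset_initial WhiteL_inj _ => i j lt_ij jP; apply/negPn/negP=> iP.
  have [k lt_jk kP] := fset_notin P j.+1 WhiteL_inj.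
  by have /negP := Pblock (WhiteL i) (WhiteL j) (WhiteL k)
    isT isT isT lt_ij lt_jk iP kP.
have [n nP] : exists n, forall i, (WhiteR i \in P) = (i < n)%N.
  apply: fset_initial WhiteR_inj _ => i j lt_ij jP; apply/negPn/negP=> iP.
  have [k lt_jk kP] := fset_notin P j.+1 WhiteR_inj.
  by have /negP := Pblock (WhiteR k) (WhiteR j) (WhiteR i)
    isT isT isT lt_jk lt_ij kP iP.
exists m, n; apply/fsetP=> s; rewrite in_wedge; case: s => i //.
- apply/idP/idP=> [iP|lt_im].
    apply/negPn/negP=> le_mi; apply: (Pexp _ iP); split=> // -[] j //=.
    by rewrite mP => /orP[]/eqP->; lia.
  apply/negPn/negP=> /Ppart /(_ (_ : on_top (WhiteL i) _)).
  by rewrite /= eqxx mP lt_im => /(_ isT).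
- apply/idP/idP=> [iP|lt_im].
    apply/negPn/negP=> le_mi; apply: (Pexp _ iP); split=> // -[] j //=.
    by rewrite nP => /orP[]/eqP->; lia.
  apply/negPn/negP=> /Ppart /(_ (_ : on_top (WhiteR i) _)).
  by rewrite /= eqxx nP lt_im => /(_ isT).
Qed.

Lemma wedge_inj m n m' n' : wedge m n = wedge m' n' -> m = m' /\ n = n'.
Proof.
move=> /fsetP eq_w; split; apply/eqP; rewrite eqn_leq; apply/andP; split.
- by have := eq_w (WhiteL m'); rewrite !in_wedge ltnn; lia.
- by have := eq_w (WhiteL m); rewrite !in_wedge ltnn; lia.
- by have := eq_w (WhiteR n'); rewrite !in_wedge ltnn; lia.
by have := eq_w (WhiteR n); rewrite !in_wedge ltnn; lia.
Qed.

(** * The partition function and the conclusion *)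

Local Open Scope ring_scope.

(** The expansion of y_0 / (1 - y_0 y_1)^2, with one geometric series for each end of the
    pyramid. *)
Definition simple_gf : fps := fun i j => if i == j.+1 then i%:Z else 0.

Lemma simple_gf_sum : is_fps_sum simple_partition weight simple_gf.
Proof.
move=> i j; have [iE|iNj] := eqVneq i j.+1; last first.
  exists fset0; last by rewrite /simple_gf (negbTE iNj) big_nil.
  move=> P; rewrite inE; split=> // -[/simple_partitionP[m [n ->]]].
  rewrite weight_wedge /fps_monomial.
  by case: andP => // -[/eqP ii /eqP jj]; rewrite ii jj eqxx in iNj.
have w_inj : injective (fun m => wedge m (j - m)) by move=> m m' /wedge_inj[].
have w1 m : (m < i)%N -> weight (wedge m (j - m)) i j = 1.
  by move=> lt_mi; rewrite weight_wedge /fps_monomial subnKC ?iE ?eqxx //; lia.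
(* The wedges with m + n = j contribute 1 each; there are j + 1 = i of them, one for each m from 0
   to j, so [j - m] never truncates. *)
exists [fset P in map (fun m => wedge m (j - m)) (iota 0 i)].
  move=> P; rewrite in_fset; split.
    move=> /mapP[m]; rewrite mem_iota /= => lt_mi ->; split.
      by apply/simple_partitionP; exists m, (j - m)%N.
    by rewrite w1.
  move=> [/simple_partitionP[m [n ->]]]; rewrite weight_wedge /fps_monomial.
  case: andP => // -[_ /eqP jE] _; apply/mapP; exists m.
    by rewrite mem_iota iE jE; lia.
  by rewrite jE addKn.
rewrite (perm_big (map (fun m => wedge m (j - m)) (iota 0 i))); last first.
  apply: uniq_perm; rewrite ?fset_uniq ?map_inj_uniq ?iota_uniq // => P.
  by rewrite in_fset.
rewrite big_map big_seq (eq_bigr (fun=> 1)) => [|m]; last first.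
  by rewrite mem_iota => /w1.
by rewrite -big_seq big_const_seq count_predT size_iota iter_addr_0
  /simple_gf iE eqxx natz.
Qed.

Theorem proposition3p14 :
  exists (Ft : nat -> fps) (S : fps),
    [/\ forall k : nat, (0 < k)%N -> stable_cluster_variable k (Ft k),
        is_fps_sum simple_partition weight S
      & fps_limit Ft (fps_add fps_one S)].
Proof.
exists (fun k i j => stable_laurent k (Fpoly k) (expo i j)), simple_gf; split.
- move=> k k_gt0; exists (Fpoly k).
    by case: k k_gt0 => // k _; case: (label_Q k) => <-.
  by split=> // i j; apply: stable_laurent_Fpoly_neg.
- exact: simple_gf_sum.
(* The coefficient is stationary once k > i, whatever j is. *)
by move=> i j; exists i.+1 => k; apply: stable_laurent_Fpoly_lim.
Qed.
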